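(* Let $\mathcal{H}$ and $\mathcal{G}$ be real Hilbert spaces, let $L\in\mathcal{B}(\mathcal{H},\mathcal{G})$ satisfy $0<\|L\|\leq 1$, let $B\in\mathcal{S}(\mathcal{G})$, and let $\gamma\in\,]0,+\infty[$. Then the following hold: (i) $L\overset{\gamma}{\bullet}B\in\mathcal{P}(\mathcal{H})$. (ii) $L\overset{\gamma}{\bullet}\mathscr{Q}_B=\mathscr{Q}_{L\overset{\gamma}{\bullet}B}$. (iii) Let $\lambda\in\,]0,1[$. Then $T_\gamma\colon\mathcal{S}(\mathcal{G})\to\mathcal{P}(\mathcal{H})\colon A\mapsto L\overset{\gamma}{\bullet}A$ is concave in the sense that, for every $A\in\mathcal{S}(\mathcal{G})$, $$\lambda\bigl(L\overset{\gamma}{\bullet}A\bigr)+(1-\lambda)\bigl(L\overset{\gamma}{\bullet}B\bigr)\preccurlyeq L\overset{\gamma}{\bullet}\bigl(\lambda A+(1-\lambda)B\bigr).$$ (iv) Suppose that $L$ is bounded below. Then the following are satisfied: (a) $L\overset{\gamma}{\bullet}B\in\mathcal{S}(\mathcal{H})$ and $L\overset{\gamma}{\diamond}B\in\mathcal{S}(\mathcal{H})$. (b) $L\overset{\gamma}{\diamond}\mathscr{Q}_B=\mathscr{Q}_{L\overset{\gamma}{\diamond}B}$. (c) Let $\lambda\in\,]0,1[$. Then $R_\gamma\colon\mathcal{S}(\mathcal{G})\to\mathcal{S}(\mathcal{H})\colon A\mapsto L\overset{\gamma}{\diamond}A$ is concave in the sense that, for every $A\in\mathcal{S}(\mathcal{G})$,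 $$\lambda\bigl(L\overset{\gamma}{\diamond}A\bigr)+(1-\lambda)\bigl(L\overset{\gamma}{\diamond}B\bigr)\preccurlyeq L\overset{\gamma}{\diamond}\bigl(\lambda A+(1-\lambda)B\bigr).$$
   Context: $\mathcal{B}(\mathcal{H},\mathcal{G})$ is the space of bounded linear operators from $\mathcal{H}$ to $\mathcal{G}$, $\mathcal{B}(\mathcal{H})=\mathcal{B}(\mathcal{H},\mathcal{H})$, and $L^*$ is the adjoint of $L$. $\mathcal{P}(\mathcal{H})$ is the set of self-adjoint $A\in\mathcal{B}(\mathcal{H})$ with $\langle Ax,x\rangle\geq 0$ for all $x\in\mathcal{H}$. For self-adjoint $A,B$, $A\preccurlyeq B$ means $B-A\in\mathcal{P}(\mathcal{H})$. $\mathcal{S}(\mathcal{H})$ is the set of $A\in\mathcal{P}(\mathcal{H})$ for which there exists $\alpha>0$ with $\alpha\,\mathrm{Id}_{\mathcal{H}}\preccurlyeq A$. $L$ is bounded below if there exists $\alpha>0$ such that $\alpha\|x\|\leq\|Lx\|$ for all $x\in\mathcal{H}$. Operations on operators. For a set-valued operator $M\colon\mathcal{G}\to 2^{\mathcal{G}}$, $M^{-1}$ is the set-valued inverse ($x\in M^{-1}y\Leftrightarrow y\in Mx$); sums and compositions are taken in the set-valued sense, e.g. $(L^*\circ M\circ L)x=\{L^*y : y\in M(Lx)\}$; a set-valued operator all of whose values are singletons is identified with the corresponding single-valued operator. The parallel composition of $M$ by $L^*$ is $L^*\triangleright M=(L^*\circ M^{-1}\circ L)^{-1}$. For $\gamma\in\,]0,+\infty[$,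 the resolvent composition is $L\overset{\gamma}{\diamond}M=L^*\triangleright(M+\gamma^{-1}\mathrm{Id}_{\mathcal{G}})-\gamma^{-1}\mathrm{Id}_{\mathcal{H}}$, and the resolvent cocomposition is $L\overset{\gamma}{\bullet}M=\bigl(L\overset{1/\gamma}{\diamond}M^{-1}\bigr)^{-1}$. Operations on functions. The quadratic kernel of $A\in\mathcal{P}(\mathcal{H})$ is $\mathscr{Q}_A\colon\mathcal{H}\to\mathbb{R}\colon x\mapsto\tfrac12\langle x,Ax\rangle$. The conjugate of $f\colon\mathcal{H}\to[-\infty,+\infty]$ is $f^*(x^* )=\sup_{x\in\mathcal{H}}(\langle x,x^*\rangle-f(x))$. The Moreau envelope of $f$ with parameter $\mu\in\,]0,+\infty[$ is ${}^{\mu}f(x)=\inf_{z\in\mathcal{H}}\bigl(f(z)+\tfrac{1}{2\mu}\|x-z\|^2\bigr)$ (the same definitions apply on $\mathcal{G}$). For $h\colon\mathcal{G}\to[-\infty,+\infty]$ and $\gamma\in\,]0,+\infty[$, the proximal composition is the function on $\mathcal{H}$ $$L\overset{\gamma}{\diamond}h=\Bigl(\bigl({}^{1/\gamma}(h^* )\bigr)\circ L\Bigr)^*-\frac{1}{2\gamma}\|\cdot\|_{\mathcal{H}}^2,$$ and the proximal cocomposition is $L\overset{\gamma}{\bullet}h=\bigl(L\overset{1/\gamma}{\diamond}h^*\bigr)^*$. The same symbols are used for operators and functions; which is meant is determined by the argument. *)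

(* Defs.v *)
From HB Require Import structures.
From mathcomp Require Import all_boot all_order all_algebra.
From mathcomp Require Import sesquilinear.
From mathcomp Require Import all_classical all_reals all_analysis.
Set Implicit Arguments.
Unset Strict Implicit.
Unset Printing Implicit Defensive.
Import Order.TTheory GRing.Theory Num.Theory.
Import numFieldNormedType.Exports.
Local Open Scope classical_set_scope.
Local Open Scope ring_scope.

(* Real Hilbert spaces: complete normed modules over R whose norm is induced
   by a symmetric (conjugation = idfun), positive definite bilinear form. *)
HB.mixin Record CompleteNormedModule_isHilbert (R : realType) H
    of CompleteNormedModule R H := {
  inner : {dot H for (@idfun R)} ;
  inner_norm : forall x : H, inner x x = `|x| ^+ 2
}.

#[short(type="hilbertType")]
HB.structure Definition Hilbert (R : realType) :=
  {H of CompleteNormedModule R H & CompleteNormedModule_isHilbert R H}.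

Notation "''[' u , v ]" := (inner u v) : ring_scope.

Section BoundedOperators.
Context {R : realType}.
Implicit Types U V H : hilbertType R.

Definition bounded_op {U V} (A : U -> V) : Prop :=
  linear A /\ bounded_fun_norm A.

Definition opnorm {U V} (A : U -> V) : R :=
  sup [set `|A x| | x in [set x : U | `|x| <= 1]].

(* For a bounded operator A the set below is a singleton for every y, by the
   Riesz representation theorem, so the default value 0 is never used. *)
Definition adjoint {U V} (A : U -> V) : V -> U := fun y =>
  xget 0 [set z : U | forall x, '[A x, y] = '[x, z]].

Definition self_adjoint {H} (A : H -> H) : Prop :=
  bounded_op A /\ adjoint A = A.

Definition positive_op {H} : set (H -> H) :=
  [set A | self_adjoint A /\ forall x, 0 <= '[A x, x]].

Definition loewner_le {H} (A B : H -> H) : Prop :=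
  [/\ self_adjoint A, self_adjoint B & positive_op (B - A)].

Definition strongly_positive_op {H} : set (H -> H) :=
  [set A | positive_op A /\
    exists2 alpha : R, 0 < alpha & loewner_le (fun x : H => alpha *: x) A].

Definition bounded_below {U V} (A : U -> V) : Prop :=
  exists2 alpha : R, 0 < alpha & forall x, alpha * `|x| <= `|A x|.

End BoundedOperators.

Section SetValuedOperators.
Context {R : realType}.
Implicit Types U V H G : hilbertType R.

Definition setop_of {U V} (A : U -> V) : U -> set V := fun x => [set A x].

Definition single_valued {U V} (M : U -> set V) : Prop :=
  forall x, exists y, M x = [set y].

(* The single-valued operator with which a set-valued operator M satisfying
   single_valued M is identified; the default 0 is irrelevant for such M. *)
Definition op_of {U V} (M : U -> set V) : U -> V := fun x => xget 0 (M x).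

(* Membership of a set-valued operator in a set of single-valued ones, under
   the identification above. *)
Definition setop_in {U V} (M : U -> set V) (P : set (U -> V)) : Prop :=
  single_valued M /\ P (op_of M).

Definition setop_inv {U V} (M : U -> set V) : V -> set U :=
  fun y => [set x | M x y].

Definition setop_add {U V} (M N : U -> set V) : U -> set V :=
  fun x => [set y + z | y in M x & z in N x].

Definition setop_scaleid {H} (a : R) : H -> set H :=
  setop_of (fun x : H => a *: x).

Definition setop_sandwich {H G} (L : H -> G) (M : G -> set G) : H -> set H :=
  fun x => [set adjoint L y | y in M (L x)].

Definition parallel_comp {H G} (L : H -> G) (M : G -> set G) : H -> set H :=
  setop_inv (setop_sandwich L (setop_inv M)).

Definition resolvent_comp {H G} (L : H -> G) (gamma : R) (M : G -> set G) :
    H -> set H :=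
  setop_add (parallel_comp L (setop_add M (setop_scaleid gamma^-1)))
            (setop_scaleid (- gamma^-1)).

Definition resolvent_cocomp {H G} (L : H -> G) (gamma : R) (M : G -> set G) :
    H -> set H :=
  setop_inv (resolvent_comp L gamma^-1 (setop_inv M)).

End SetValuedOperators.

Section Functions.
Context {R : realType}.
Implicit Types H G : hilbertType R.
Local Open Scope ereal_scope.

Definition quad_kernel {H} (A : H -> H) : H -> \bar R :=
  fun x => (2^-1 * '[x, A x])%:E.

Definition conjugate {H} (f : H -> \bar R) : H -> \bar R :=
  fun u => ereal_sup [set ('[x, u])%:E - f x | x in [set: H]].

Definition moreau_env {H} (mu : R) (f : H -> \bar R) : H -> \bar R :=
  fun x => ereal_inf
    [set f z + ((2 * mu)^-1 * `|x - z| ^+ 2)%:E | z in [set: H]].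

Definition prox_comp {H G} (L : H -> G) (gamma : R) (h : G -> \bar R) :
    H -> \bar R :=
  fun x => conjugate (moreau_env gamma^-1 (conjugate h) \o L) x
           - ((2 * gamma)^-1 * `|x| ^+ 2)%:E.

Definition prox_cocomp {H G} (L : H -> G) (gamma : R) (h : G -> \bar R) :
    H -> \bar R :=
  conjugate (prox_comp L gamma^-1 (conjugate h)).

End Functions.

(* The compositions of a single-valued A : G -> G, identified with a
   single-valued operator on H. *)
Notation res_comp L gamma A :=
  (op_of (resolvent_comp L gamma (setop_of A))).
Notation res_cocomp L gamma A :=
  (op_of (resolvent_cocomp L gamma (setop_of A))).

(* Main.v *)
(* Riesz's theorem and the inverses of strongly positive operators both come
   from minimizing [1/2 <A x, x> - f x]. Put [N = gamma (Id - L L^* )], which is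
   positive as [|L| <= 1]. Unfolding the set-valued operations, the
   cocomposition of [B] is [D = L^* (B^-1 + N)^-1 L] and, when [L] is bounded
   below, its composition is [W - gamma^-1 Id] with
   [W = (L^* (B + gamma^-1 Id)^-1 L)^-1].
   Concavity in [B] follows as both quadratic forms are minima of functions
   affine in [B]:
     [<D y, y> = min {<B z, z> + <N v, v> | L y = z + N v}],
     [<W x, x> = min {<B v, v> + gamma^-1 |v|^2 | L^* v = x}].
   In (ii), the envelope of the kernel of [B] becomes the quadratic
   kernel of [K = L^* (B^-1 + gamma Id)^-1 L] after composition with [L]. Since
   [K] need not be invertible, its conjugate may take the value [+oo], and the
   final conjugation is evaluated with the test point [y + gamma u]. *)
From mathcomp Require Import all_boot all_order all_algebra sesquilinear.
Require Import Defs.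
From mathcomp Require Import all_classical all_reals all_analysis ring lra.
Set Implicit Arguments.
Unset Strict Implicit.
Unset Printing Implicit Defensive.
Import Order.TTheory GRing.Theory Num.Theory.
Import numFieldNormedType.Exports.
Local Open Scope classical_set_scope.
Local Open Scope ring_scope.

(** * Inner product identities and the Cauchy-Schwarz inequality *)

Section InnerProduct.
Context {R : realType} {H : hilbertType R}.
Implicit Types (x y z : H) (a : R).

Lemma innerC x y : '[x, y] = '[y, x].
Proof. by rewrite hermC /= expr0 mul1r. Qed.

Lemma innerDl x y z : '[x + y, z] = '[x, z] + '[y, z].
Proof. by rewrite linearDl. Qed.

Lemma innerDr x y z : '[z, x + y] = '[z, x] + '[z, y].
Proof. by rewrite !(innerC z) innerDl. Qed.

Lemma innerZl a x y : '[a *: x, y] = a * '[x, y].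
Proof. by rewrite linearZl_LR. Qed.

Lemma innerZr a x y : '[x, a *: y] = a * '[x, y].
Proof. by rewrite !(innerC x) innerZl. Qed.

Lemma innerNl x y : '[- x, y] = - '[x, y].
Proof. by rewrite -scaleN1r innerZl mulN1r. Qed.

Lemma innerNr x y : '[x, - y] = - '[x, y].
Proof. by rewrite !(innerC x) innerNl. Qed.

Lemma innerBl x y z : '[x - y, z] = '[x, z] - '[y, z].
Proof. by rewrite innerDl innerNl. Qed.

Lemma innerBr x y z : '[z, x - y] = '[z, x] - '[z, y].
Proof. by rewrite innerDr innerNr. Qed.

Lemma inner0l x : '[0, x] = 0.
Proof. by rewrite -(subrr 0) innerBl subrr. Qed.

Lemma inner0r x : '[x, 0] = 0.
Proof. by rewrite innerC inner0l. Qed.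

Definition innerE := (innerDl, innerDr, innerNl, innerNr, innerZl, innerZr).

Lemma inner_ge0 x : 0 <= '[x, x].
Proof. by rewrite inner_norm sqr_ge0. Qed.

Lemma eq_inner x y : (forall z, '[x, z] = '[y, z]) -> x = y.
Proof.
move=> xy; apply/eqP; rewrite -subr_eq0 -normr_eq0 -sqrf_eq0 -inner_norm.
by rewrite innerBl xy subrr.
Qed.

Lemma cauchy_schwarz x y : `|'[x, y]| <= `|x| * `|y|.
Proof.
have [->|y0] := eqVneq y 0.
  by rewrite inner0r !normr0 mulr0.
have ny : 0 < `|y| by rewrite normr_gt0.
(* The signs [s = 1] and [s = -1] give the two halves of the absolute value. Each comes from
   expanding the squared norm of [|y| x - s |x| y]. *)
have key s : s ^+ 2 = 1 -> s * '[x, y] <= `|x| * `|y|.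
  move=> s1.
  have [->|x0] := eqVneq x 0.
    by rewrite inner0l !normr0 mul0r mulr0.
  have := inner_ge0 (`|y| *: x - (s * `|x|) *: y).
  rewrite !innerE !inner_norm (innerC y x).
  have nx : 0 < `|x| by rewrite normr_gt0.
  rewrite [leRHS](_ : _ = (1 + s ^+ 2) * (`|x| * `|y|) ^+ 2
    - 2 * (`|x| * `|y|) * (s * '[x, y])); last by ring.
  rewrite s1; have xy := mulr_gt0 nx ny; nra.
by rewrite ler_norml -{1}[X in - X]mul1r; have := key 1; have := key (-1);
  rewrite sqrrN expr1n => /(_ erefl) ? /(_ erefl) ?; apply/andP; split; lra.
Qed.

End InnerProduct.

(** * Linear maps and boundedness *)

Section LinearMaps.
Context {R : realType} {U V : lmodType R} (A : U -> V) (linA : linear A).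

Lemma linD x y : A (x + y) = A x + A y.
Proof. by rewrite -{1}[x]scale1r linA scale1r. Qed.

Lemma lin0 : A 0 = 0.
Proof. by apply: (addrI (A 0)); rewrite -linD !addr0. Qed.

Lemma linZ a x : A (a *: x) = a *: A x.
Proof. by rewrite -[a *: x]addr0 linA lin0 addr0. Qed.

Lemma linN x : A (- x) = - A x.
Proof. by rewrite -scaleN1r linZ scaleN1r. Qed.

Lemma linB x y : A (x - y) = A x - A y.
Proof. by rewrite linD linN. Qed.

End LinearMaps.

Section BoundedOp.
Context {R : realType} {U V : hilbertType R}.
Implicit Types A : U -> V.

(** Homogeneity turns a bound on the unit ball into one proportional to the norm. *)
Lemma bounded_opP A : bounded_op A <->
  linear A /\ exists2 b : R, 0 < b & forall x, `|A x| <= b * `|x|.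
Proof.
split=> [[linA bA]|[linA [b b0 bA]]].
  split => //; have [M hM] := bA 1.
  have M0 : 0 <= M by apply: le_trans (hM 0 _); rewrite ?normr0.
  (* [M] may be zero; adding 1 makes the constant strictly positive. *)
  exists (M + 1); first by lra.
  move=> x; have [->|x0] := eqVneq x 0; first by rewrite (lin0 linA) !normr0 mulr0.
  have nx : 0 < `|x| by rewrite normr_gt0.
  have := hM (`|x|^-1 *: x); rewrite (linZ linA) !normrZ !normfV normr_id.
  rewrite mulVf ?gt_eqF // => /(_ (lexx _)); rewrite ler_pdivrMl // => h.
  by nra.
split => // r; exists (b * r) => x xr; apply: le_trans (bA x) _.
by rewrite ler_pM2l.
Qed.

End BoundedOp.

(** * Minimization of coercive quadratic functionals *)

Section LaxMilgram.
Context {R : realType} {H : hilbertType R}.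
Variables (A : H -> H) (a b M : R) (f : H -> R).
Hypotheses (linA : linear A) (symA : forall x y, '[A x, y] = '[x, A y]).
Hypotheses (a0 : 0 < a) (coerA : forall x, a * `|x| ^+ 2 <= '[A x, x]).
Hypotheses (b0 : 0 < b) (boundA : forall x, `|A x| <= b * `|x|).
Hypotheses (linf : scalar f) (boundf : forall x, `|f x| <= M * `|x|).

Let J x := 2^-1 * '[A x, x] - f x.

Let fZ t x : f (t *: x) = t * f x.
Proof. exact: (linZ (linf : linear (f : H -> R^o))). Qed.

Let fD x y : f (x + y) = f x + f y.
Proof. exact: (linD (linf : linear (f : H -> R^o))). Qed.

Let J_expand x t h :
  J (x + t *: h) = J x + t * ('[A x, h] - f h) + t ^+ 2 * (2^-1 * '[A h, h]).
Proof.
rewrite /J fD fZ (linD linA) (linZ linA) !innerE (symA h x) (innerC h). by field.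
Qed.

(** By coercivity [J x >= a / 2 |x|^2 - M |x|]; completing the square in [|x|] gives the bound. *)
Let J_bounded x : - (M ^+ 2 / (2 * a)) <= J x.
Proof.
rewrite /J; have := boundf x; have := coerA x; rewrite ler_norml.
move=> h /andP[_ fx].
suff : 0 <= a * `|x| ^+ 2 - 2 * M * `|x| + M ^+ 2 / a.
  have -> : M ^+ 2 / (2 * a) = 2^-1 * (M ^+ 2 / a) by field; exact: lt0r_neq0.
  by move=> ?; lra.
have -> : a * `|x| ^+ 2 - 2 * M * `|x| + M ^+ 2 / a = a * (`|x| - M / a) ^+ 2.
  by field; exact: lt0r_neq0.
by rewrite mulr_ge0 ?sqr_ge0 // ltW.
Qed.

Let m := inf (range J).

Let has_inf_J : has_inf (range J).
Proof.
split; first by exists (J 0), 0.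
by exists (- (M ^+ 2 / (2 * a))) => _ [x _ <-]; exact: J_bounded.
Qed.

Let J_ge x : m <= J x.
Proof. by apply: ge_inf; [exact: has_inf_J.2|exists x]. Qed.

(** Parallelogram argument: [J x + J y - 2 J ((x + y) / 2)] equals a quarter of the form at [x - y],
    and it is below [2 e] because the midpoint value is at least [m]. *)
Let J_near e x y : J x < m + e -> J y < m + e -> `|x - y| ^+ 2 <= 8 * e / a.
Proof.
move=> Jx Jy; have := J_ge (2^-1 *: (x + y)).
rewrite ler_pdivlMr // mulrC; have := coerA (x - y).
move: Jx Jy; rewrite /J (linB linA) !(linZ linA) !(linD linA) fZ fD !innerE.
by rewrite (symA x y) (innerC x); lra.
Qed.

(** Completeness enters here: a minimizing sequence is Cauchy by [J_near]. Its limit [z] is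
    described by near-minimizers close to it, so continuity of [J] does not have to be
    established. *)
Let minimizing : exists z, forall e : R, 0 < e -> exists x, `|z - x| < e /\ J x < m + e.
Proof.
have /choice[u hu] (n : nat) : exists x, J x < m + n.+1%:R^-1.
  have [|_ [x _ <-] Jx] := inf_adherent (_ : 0 < n.+1%:R^-1) has_inf_J.
    by rewrite invr_gt0.
  by exists x.
have uJ e : 0 < e -> \forall n \near \oo, J (u n) < m + e.
  move=> e0; near=> n; apply: lt_trans (hu n) _; rewrite ltrD2l.
  by near: n; exact: near_infty_natSinv_lt (PosNum e0).
have cu : cvg (u @ \oo).
  apply: cauchy_cvg; apply: cauchy_exP => e e0.
  (* With this tolerance [J_near] bounds the squared distance by [e ^+ 2 / 2]. *)
  have d0 : 0 < a * e ^+ 2 / 16 by rewrite divr_gt0 ?mulr_gt0 ?exprn_gt0.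
  have [n _ hn] := uJ _ d0; exists (u n); exists n => // k nk /=.
  rewrite -ball_normE /= -ltr_sqr ?nnegrE ?(ltW e0) //.
  apply: le_lt_trans (J_near (hn n _) (hn k _)) _ => //=.
  have -> : 8 * (a * e ^+ 2 / 16) / a = e ^+ 2 / 2 by field; exact: lt0r_neq0.
  by have := exprn_gt0 2 e0; lra.
exists (lim (u @ \oo)) => e e0.
have /cvgrPdist_lt /(_ e e0) nu : u @ \oo --> lim (u @ \oo) by [].
have [n [h1 h2]] : exists n, `|lim (u @ \oo) - u n| < e /\ J (u n) < m + e.
  by apply: (@filter_ex _ \oo); apply: filterI => //; exact: uJ.
by exists (u n).
Unshelve. all: by end_near. Qed.

(** First-order condition at [z]: a near-minimizer [x] close to [z] is moved by [t h], and the
    resulting inequality is divided by [t]. *)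
Lemma lax_milgram : exists z, forall h, '[A z, h] = f h.
Proof.
have [z hz] := minimizing; exists z.
have key h : f h <= '[A z, h].
  (* The summands of [c] are the three errors of order [t]: the defect [t ^+ 2] of [J x] divided by
     [t], the second-order term, and the replacement of [x] by [z]. *)
  set c := 1 + 2^-1 * '[A h, h] + b * `|h|.
  have c0 : 0 < c.
    have := coerA h; have := mulr_ge0 (ltW a0) (sqr_ge0 `|h|).
    by have := mulr_ge0 (ltW b0) (normr_ge0 h); rewrite /c; lra.
  apply/ler_addgt0Pr => e e0.
  pose t := Num.min 1 (e / c).
  have t0 : 0 < t by rewrite lt_min ltr01 divr_gt0.
  have t1 : t <= 1 by rewrite ge_min lexx.
  have tc : t * c <= e by rewrite -ler_pdivlMr // ge_min lexx orbT.
  have [x [zx Jx]] := hz (t ^+ 2) (exprn_gt0 2 t0).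
  have := J_ge (x + t *: h); rewrite J_expand => Jm.
  have : 0 <= t * (t + ('[A x, h] - f h) + t * (2^-1 * '[A h, h])) by nra.
  rewrite pmulr_rge0 // => h1.
  have : '[A x, h] - '[A z, h] <= b * t * `|h|.
    rewrite -innerBl -(linB linA); apply: le_trans (ler_norm _) _.
    apply: le_trans (cauchy_schwarz _ _) _; apply: ler_wpM2r => //.
    apply: le_trans (boundA _) _; rewrite ler_pM2l // distrC.
    by apply: le_trans (ltW zx) _; nra.
  by rewrite /c in tc; nra.
(* Both sides are odd in [h], so [key] at [- h] is the reverse inequality. *)
move=> h; apply/eqP; rewrite eq_le key andbT.
have := key (- h); rewrite innerNr -(scaleN1r h) fZ; lra.
Qed.

End LaxMilgram.

(** * Adjoints and operations preserving boundedness *)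

Section Adjoint.
Context {R : realType} {U V : hilbertType R}.
Implicit Types A : U -> V.

Lemma adjoint_unique A B : (forall x y, '[A x, y] = '[x, B y]) -> adjoint A = B.
Proof.
move=> AB; apply/funext => y; apply: eq_inner => z.
have : [set w : U | forall x, '[A x, y] = '[x, w]] (adjoint A y).
  by apply: (@xgetPex _ 0); exists (B y) => x.
by move=> /(_ z); rewrite AB !(innerC z).
Qed.

Lemma adjointP A : bounded_op A -> forall x y, '[A x, y] = '[x, adjoint A y].
Proof.
move=> /bounded_opP[linA [b b0 bA]] x y; move: x.
suff : [set w : U | forall x, '[A x, y] = '[x, w]] (adjoint A y) by [].
apply: (@xgetPex _ 0).
suff [z hz] : exists z, forall x, '[idfun z, x] = '[A x, y].
  by exists z => x; rewrite -hz innerC.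
(* Riesz representation is the case of the identity operator; Cauchy-Schwarz bounds the functional
   by [b * |y|]. *)
apply: (@lax_milgram R U idfun 1 1 (b * `|y|)) => // [x|x|t u v|x].
- by rewrite mul1r inner_norm.
- by rewrite mul1r.
- by rewrite linA !innerE.
- apply: le_trans (cauchy_schwarz _ _) _.
  by rewrite mulrAC ler_wpM2r.
Qed.

(** Divide [|A^* y|^2 = <A A^* y, y> <= b |A^* y| |y|] by [|A^* y|]. *)
Lemma norm_adjoint_le A b : bounded_op A -> 0 <= b ->
  (forall x, `|A x| <= b * `|x|) -> forall y, `|adjoint A y| <= b * `|y|.
Proof.
move=> bA b0 hA y; have [->|y0] := eqVneq (adjoint A y) 0.
  by rewrite normr0 mulr_ge0.
rewrite -(ler_pM2r (_ : 0 < `|adjoint A y|)) ?normr_gt0 //.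
rewrite -expr2 -inner_norm -adjointP //.
apply: le_trans (ler_norm _) _; apply: le_trans (cauchy_schwarz _ _) _.
by rewrite mulrAC ler_wpM2r.
Qed.

End Adjoint.

Section BoundedOpClosure.
Context {R : realType} {U V W : hilbertType R}.

Lemma bounded_op_adjoint (A : U -> V) : bounded_op A -> bounded_op (adjoint A).
Proof.
move=> bA; have [linA [b b0 hA]] := (bounded_opP A).1 bA.
apply/bounded_opP; split; last first.
  by exists b => // x; apply: norm_adjoint_le => //; exact: ltW.
move=> t x y; apply: eq_inner => z.
by rewrite !innerE !(innerC _ z) -!adjointP // !innerE.
Qed.

Lemma bounded_op_comp (A : U -> V) (B : V -> W) :
  bounded_op A -> bounded_op B -> bounded_op (B \o A).
Proof.
move=> /bounded_opP[linA [a a0 hA]] /bounded_opP[linB [b b0 hB]].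
apply/bounded_opP; split; first by move=> t x y; rewrite /= linA linB.
exists (b * a) => [|x /=]; first exact: mulr_gt0.
by apply: le_trans (hB _) _; rewrite -mulrA ler_pM2l.
Qed.

Lemma bounded_opD (A B : U -> V) :
  bounded_op A -> bounded_op B -> bounded_op (A + B).
Proof.
move=> /bounded_opP[linA [a a0 hA]] /bounded_opP[linB [b b0 hB]].
apply/bounded_opP; split.
  by move=> t x y; rewrite !fctE linA linB scalerDr addrACA.
exists (a + b) => [|x]; first exact: addr_gt0.
by rewrite fctE mulrDl; apply: le_trans (ler_normD _ _) _; exact: lerD.
Qed.

Lemma bounded_opZ (A : U -> V) (a : R) : bounded_op A -> bounded_op (a *: A).
Proof.
move=> /bounded_opP[linA [b b0 hA]]; apply/bounded_opP; split.
  by move=> t x y; rewrite !fctE linA scalerDr !scalerA mulrC.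
exists ((`|a| + 1) * b) => [|x]; first by rewrite mulr_gt0 // ltr_wpDl.
rewrite fctE normrZ -mulrA; apply: ler_pM => //.
by rewrite lerDl.
Qed.

Lemma bounded_op_id : bounded_op (@idfun U).
Proof.
by apply/bounded_opP; split => //; exists 1 => // x; rewrite mul1r.
Qed.

End BoundedOpClosure.

(** * Positive and strongly positive operators *)

Definition symmetric_op {R : realType} {H : hilbertType R} (A : H -> H) :=
  forall x y, '[A x, y] = '[x, A y].

Definition coercive {R : realType} {H : hilbertType R} (a : R) (A : H -> H) :=
  forall x, a * `|x| ^+ 2 <= '[A x, x].

Section PositiveOp.
Context {R : realType} {H : hilbertType R}.
Implicit Types (A B : H -> H) (a : R).

Lemma self_adjointP A : self_adjoint A <-> bounded_op A /\ symmetric_op A.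
Proof.
split=> -[bA hA]; split => //; last exact: adjoint_unique.
by move=> x y; rewrite adjointP // hA.
Qed.

Lemma positive_opP A : positive_op A <->
  [/\ bounded_op A, symmetric_op A & forall x, 0 <= '[A x, x]].
Proof.
by split=> [[/self_adjointP[]]|[bA sA]]; split=> //; apply/self_adjointP.
Qed.

Lemma positive_opD A B : positive_op A -> positive_op B -> positive_op (A + B).
Proof.
move=> /positive_opP[bA sA pA] /positive_opP[bB sB pB]; apply/positive_opP.
split; first exact: bounded_opD.
  by move=> x y; rewrite !fctE !innerE sA sB.
by move=> x; rewrite fctE innerE addr_ge0.
Qed.

Lemma positive_opZ A a : 0 <= a -> positive_op A -> positive_op (a *: A).
Proof.
move=> a0 /positive_opP[bA sA pA]; apply/positive_opP.
split; first exact: bounded_opZ.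
  by move=> x y; rewrite !fctE !innerE sA.
by move=> x; rewrite fctE innerE mulr_ge0.
Qed.

Lemma positive_op_id : positive_op (@idfun H).
Proof.
apply/positive_opP; split=> [| |x] //; first exact: bounded_op_id.
exact: inner_ge0.
Qed.

(** Self-adjointness of the difference is inherited, so only the quadratic forms need comparing. *)
Lemma loewner_leP A B : positive_op A -> positive_op B ->
  (forall x, '[A x, x] <= '[B x, x]) -> loewner_le A B.
Proof.
move=> pA pB AB; split; [exact: pA.1|exact: pB.1|].
move: pA pB => /positive_opP[bA sA _] /positive_opP[bB sB _].
have -> : B - A = B + (-1) *: A by rewrite scaleN1r.
apply/positive_opP; split; first exact/bounded_opD/bounded_opZ.
  by move=> x y; rewrite !fctE !innerE sA sB.
by move=> x; rewrite !fctE !innerE mulN1r subr_ge0.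
Qed.

Lemma strongly_positive_opP A : strongly_positive_op A <->
  positive_op A /\ exists2 a, 0 < a & coercive a A.
Proof.
split=> -[pA [a a0 hA]]; split => //; exists a => //.
  move=> x; case: hA => _ _ [_ /(_ x)].
  by rewrite !fctE !innerE inner_norm subr_ge0.
apply: loewner_leP => // [|x]; last by rewrite innerZl inner_norm.
exact: (positive_opZ (ltW a0) positive_op_id).
Qed.

Lemma strongly_positive_positive A : strongly_positive_op A -> positive_op A.
Proof. by case. Qed.

Lemma strongly_positive_opD A B :
  strongly_positive_op A -> positive_op B -> strongly_positive_op (A + B).
Proof.
move=> /strongly_positive_opP[pA [a a0 hA]] pB; apply/strongly_positive_opP.
split; first exact: positive_opD.
exists a => // x; rewrite fctE innerE; apply: le_trans (hA x) _.
by rewrite lerDl; exact: pB.2.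
Qed.

Lemma strongly_positive_opZ A a :
  0 < a -> strongly_positive_op A -> strongly_positive_op (a *: A).
Proof.
move=> a0 /strongly_positive_opP[pA [b b0 hA]]; apply/strongly_positive_opP.
split; first exact: (positive_opZ (ltW a0)).
exists (a * b); first exact: mulr_gt0.
by move=> x; rewrite fctE innerE -mulrA ler_pM2l.
Qed.

(** Lax-Milgram gives surjectivity, and coercivity gives injectivity together with the bound [a^-1]
    on the inverse. *)
Lemma strongly_positive_inverse A : strongly_positive_op A ->
  exists C, [/\ strongly_positive_op C, cancel A C & cancel C A].
Proof.
move=> /strongly_positive_opP[/positive_opP[bA sA _] [a a0 hA]].
have [linA [b b0 hb]] := (bounded_opP A).1 bA.
have /choice[C hC] y : exists z, A z = y.
  have [||z hz] := @lax_milgram R H A a b `|y| (fun x => '[y, x]) linA sA a0 hA b0 hb.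
  - by move=> t u v; rewrite !innerE.
  - by move=> x; exact: cauchy_schwarz.
  - by exists z; apply: eq_inner => h; exact: hz.
have normA x : a * `|x| <= `|A x|.
  have [->|x0] := eqVneq x 0; first by rewrite normr0 mulr0.
  rewrite -(ler_pM2r (_ : 0 < `|x|)) ?normr_gt0 // -mulrA -expr2.
  by apply: le_trans (hA x) _; apply: le_trans (ler_norm _) _; exact: cauchy_schwarz.
have injA : injective A.
  move=> x y xy; apply/eqP; rewrite -subr_eq0 -normr_le0.
  by have := normA (x - y); rewrite (linB linA) xy subrr normr0 pmulr_rle0.
have CK : cancel A C by move=> x; apply: injA; rewrite hC.
exists C; split => //; apply/strongly_positive_opP.
have sC : symmetric_op C by move=> x y; rewrite -{1}(hC y) -sA hC.
(* [<C x, x> = <A (C x), C x> >= a |C x|^2], while [|x| = |A (C x)| <= b |C x|]. *)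
have cC : coercive (a / b ^+ 2) C.
  move=> x; have -> : '[C x, x] = '[A (C x), C x] by rewrite hC innerC.
  apply: le_trans (hA (C x)).
  rewrite -mulrA ler_pM2l // mulrC ler_pdivrMr ?exprn_gt0 // mulrC -exprMn.
  by rewrite ler_sqr ?nnegrE ?mulr_ge0 ?(ltW b0) // -{1}(hC x).
have ab : 0 < a / b ^+ 2 by rewrite divr_gt0 ?exprn_gt0.
split; last by exists (a / b ^+ 2).
apply/positive_opP; split => //.
  apply/bounded_opP; split.
    by move=> t x y; apply: injA; rewrite linA !hC.
  exists a^-1; first by rewrite invr_gt0.
  by move=> x; rewrite -{2}(hC x) ler_pdivlMl.
by move=> x; apply: le_trans (cC x); rewrite mulr_ge0 ?sqr_ge0 // ltW.
Qed.

End PositiveOp.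

(** * Sandwiching between a bounded operator and its adjoint *)

Section Sandwich.
Context {R : realType} {H G : hilbertType R} (L : H -> G).
Hypothesis bL : bounded_op L.

Lemma positive_op_sandwich (P : G -> G) :
  positive_op P -> positive_op (adjoint L \o P \o L).
Proof.
move=> /positive_opP[bP sP pP]; apply/positive_opP; split.
- by do 2 apply: bounded_op_comp => //; exact: bounded_op_adjoint.
- by move=> x y /=; rewrite innerC -!adjointP // innerC sP.
- by move=> x /=; rewrite innerC -adjointP // innerC.
Qed.

Lemma strongly_positive_op_sandwich (P : G -> G) : bounded_below L ->
  strongly_positive_op P -> strongly_positive_op (adjoint L \o P \o L).
Proof.
move=> [l l0 hl] /strongly_positive_opP[pP [a a0 hP]].
apply/strongly_positive_opP; split; first exact: positive_op_sandwich.
exists (a * l ^+ 2) => [|x /=]; first by rewrite mulr_gt0 ?exprn_gt0.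
rewrite innerC -adjointP // innerC; apply: le_trans (hP _).
rewrite -mulrA ler_pM2l // -exprMn ler_sqr ?nnegrE // mulr_ge0 //.
exact: ltW.
Qed.

Hypothesis L1 : opnorm L <= 1.

Lemma opnorm_le1 x : `|L x| <= `|x|.
Proof.
have [linL [b b0 hb]] := (bounded_opP L).1 bL.
have [->|x0] := eqVneq x 0; first by rewrite (lin0 linL) !normr0.
have nx : 0 < `|x| by rewrite normr_gt0.
have : `|L (`|x|^-1 *: x)| <= 1.
  apply: le_trans L1; apply: ub_le_sup; last first.
    by exists (`|x|^-1 *: x) => //=; rewrite normrZ normfV normr_id mulVf ?gt_eqF.
  (* The set whose supremum is [opnorm L] is bounded above by [b]. *)
  exists b => _ [y /= y1 <-]; apply: le_trans (hb y) _.
  by rewrite -[leRHS]mulr1 ler_pM2l.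
by rewrite (linZ linL) normrZ normfV normr_id ler_pdivrMl // mulr1.
Qed.

Lemma adjoint_le1 y : `|adjoint L y| <= `|y|.
Proof.
have := @norm_adjoint_le _ _ _ L 1 bL ler01 _ y; rewrite mul1r; apply.
by move=> x; rewrite mul1r opnorm_le1.
Qed.

End Sandwich.

(** * Resolvent compositions of single-valued operators *)

Section SetValued.
Context {R : realType}.
Implicit Types U V H G : hilbertType R.

Lemma op_of_setop_of U V (f : U -> V) : op_of (setop_of f) = f.
Proof. by apply/funext => x; exact: (@xgetPex _ 0 (setop_of f x) (ex_intro _ _ erefl)). Qed.

Lemma setop_in_setop_of U V (f : U -> V) (P : set (U -> V)) :
  P f -> setop_in (setop_of f) P.
Proof. by move=> Pf; split; [move=> x; exists (f x)|rewrite op_of_setop_of]. Qed.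

(** Here [p] is a value of the parallel composition at [x], and [v] belongs to the inverse of
    [M + g^-1 Id] at [L p]. *)
Lemma resolvent_compP H G (L : H -> G) (g : R) (M : G -> set G) (x y : H) :
  resolvent_comp L g M x y <-> exists p v w,
    [/\ M v w, L p = w + g^-1 *: v, x = adjoint L v & y = p - g^-1 *: x].
Proof.
split.
  by move=> [p [v [w Mvw [_ -> wv]] vx] [_ -> py]]; exists p, v, w;
    split; rewrite -?scaleNr.
move=> [p [v [w [Mvw Lp -> ->]]]].
exists p; first by exists v => //; exists w => //; exists (g^-1 *: v).
by exists (- g^-1 *: adjoint L v) => //; rewrite scaleNr.
Qed.

Variables (H G : hilbertType R) (L : H -> G) (gamma : R).

(** Membership forces [v = Q (L p)], hence [x = K p] and [p = W x]. *)
Lemma resolvent_compE (B Q : G -> G) (W : H -> H) :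
  let P v := B v + gamma^-1 *: v in let K := adjoint L \o Q \o L in
  cancel P Q -> cancel Q P -> cancel K W -> cancel W K ->
  resolvent_comp L gamma (setop_of B) = setop_of (fun x => W x - gamma^-1 *: x).
Proof.
move=> P K PK QK KK WK; apply/funext => x; apply/seteqP; split => y /=.
  move/resolvent_compP => [p [v [_ [-> Lp xv ->]]]]; congr (_ - _).
  by rewrite -(KK p) /K /= Lp [Q _]PK -xv.
move=> ->; apply/resolvent_compP; exists (W x), (Q (L (W x))), (B (Q (L (W x)))).
by split => //; rewrite ?[RHS]QK // [RHS]WK.
Qed.

Hypothesis gamma0 : 0 < gamma.

(** Membership reads [L p = C v + gamma v] with [x = L^* v] and [p = y + gamma x]. Eliminating [p]
    leaves [L y = M v]. *)
Lemma resolvent_cocompE (B C S : G -> G) : linear L ->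
  let M v := C v + gamma *: (v - L (adjoint L v)) in
  cancel B C -> cancel C B -> cancel M S -> cancel S M ->
  resolvent_cocomp L gamma (setop_of B) = setop_of (adjoint L \o S \o L).
Proof.
move=> linL M BK CK MK SK; apply/funext => y; apply/seteqP; split => x /=.
  move/resolvent_compP; rewrite invrK => -[p [v [w [vw Lp xv yp]]]].
  rewrite xv yp; congr adjoint; rewrite -[LHS]MK; congr S.
  rewrite /M (linB linL) (linZ linL) Lp xv vw BK scalerBr addrA.
  by [].
move=> ->; set v := S (L y); apply/resolvent_compP; rewrite invrK.
exists (y + gamma *: adjoint L v), v, (C v); split => //.
- rewrite (linD linL) (linZ linL) -{1}(SK (L y)) -/v /M scalerBr -!addrA.
  by rewrite addNr addr0.
- by rewrite addrK.
Qed.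

End SetValued.

(** * Conjugates and Moreau envelopes of quadratic kernels *)

Section Conjugate.
Context {R : realType} {H : hilbertType R}.
Implicit Types (A : H -> H).

Lemma positive_op_expand A x h : positive_op A ->
  '[A (x + h), x + h] = '[A x, x] + 2 * '[A x, h] + '[A h, h].
Proof.
move=> /positive_opP[[linA _] sA _]; rewrite (linD linA) !innerE.
by rewrite (sA h x) (innerC h); ring.
Qed.

(** Gradient inequality: the remainder is the nonnegative form at [y - x]. It certifies the optimal
    points below. *)
Lemma positive_op_convex A x y : positive_op A ->
  '[A x, x] + 2 * '[A x, y - x] <= '[A y, y].
Proof.
move=> pA; have /positive_opP[_ _ /(_ (y - x))] := pA.
have -> : '[A y, y] = '[A (x + (y - x)), x + (y - x)] by rewrite subrKC.
by rewrite positive_op_expand // lerDl.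
Qed.

Lemma conjugate_ge (f : H -> \bar R) x u : (('[x, u])%:E - f x <= conjugate f u)%E.
Proof. by apply: ereal_sup_ubound; exists x. Qed.

(** The supremum is attained at [p], where the gradient is [A p]. Working on the range of [A] also
    covers operators without an inverse. *)
Lemma conjugate_quad_image A p : positive_op A ->
  conjugate (quad_kernel A) (A p) = (2^-1 * '[A p, p])%:E.
Proof.
move=> pA; apply/eqP; rewrite eq_le; apply/andP; split.
  apply: ge_ereal_sup => _ [x _ <-]; rewrite -EFinB lee_fin.
  have := positive_op_convex p x pA; rewrite innerBr (innerC x (A p)).
  by rewrite (innerC x (A x)); lra.
apply: le_trans (conjugate_ge _ p _); rewrite -EFinB lee_fin.
by rewrite (innerC p); lra.
Qed.

Lemma conjugate_quad A C : positive_op A -> cancel C A ->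
  conjugate (quad_kernel A) = quad_kernel C.
Proof.
by move=> pA CK; apply/funext => u; rewrite -{1}(CK u) conjugate_quad_image // CK.
Qed.

(** The relation between [x] and [z] is the optimality condition making [z] the proximal point of
    [x]. *)
Lemma moreau_env_quad A (mu : R) x z : positive_op A -> 0 < mu ->
  x = z + mu *: A z -> moreau_env mu (quad_kernel A) x = (2^-1 * '[x, A z])%:E.
Proof.
move=> pA mu0 xz; apply/eqP; rewrite eq_le; apply/andP; split.
  apply: ge_ereal_inf; eexists; first by exists z.
  rewrite -EFinD lee_fin xz addrAC subrr add0r normrZ exprMn -inner_norm !innerE.
  rewrite gtr0_norm // le_eqVlt; apply/orP; left; apply/eqP.
  by field; exact: lt0r_neq0.
apply: le_ereal_inf_tmp => _ [y _ <-]; rewrite -EFinD lee_fin.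
have := positive_op_convex z y pA; rewrite (innerC y (A y)).
(* Expand the square of [x - y = mu A z + (z - y)]; its cross term cancels the linear term of the
   gradient inequality. *)
have -> : (2 * mu)^-1 * `|x - y| ^+ 2 =
    2^-1 * (mu * '[A z, A z] + 2 * '[A z, z - y] + mu^-1 * `|z - y| ^+ 2).
  rewrite xz addrAC -!inner_norm !innerE (innerC z (A z)) (innerC y (A z)).
  by field; exact: lt0r_neq0.
have := mulr_ge0 (ltW (_ : 0 < mu^-1)) (sqr_ge0 `|z - y|); rewrite invr_gt0.
move=> /(_ mu0); rewrite xz !innerE (innerC z (A z)); lra.
Qed.

(** The supremum is attained at [u0], which lies in the range of [K]. For other [u], the test point
    bounds the inner conjugate from below, and [gamma K <= Id] makes the terms in [u - u0]
    cancel. *)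
Lemma conjugate_quad_shift (K : H -> H) (gamma : R) y u0 : positive_op K -> 0 < gamma ->
  (forall x, gamma * '[K x, x] <= `|x| ^+ 2) ->
  K (y + gamma *: u0) = u0 ->
  conjugate (fun u => conjugate (quad_kernel K) u
    - (2^-1 * gamma * `|u| ^+ 2)%:E)%E y = (2^-1 * '[y, u0])%:E.
Proof.
move=> pK gamma0 K1 Ku0; apply/eqP; rewrite eq_le; apply/andP; split.
  apply: ge_ereal_sup => _ [u _ <-].
  have := conjugate_ge (quad_kernel K) (y + gamma *: u) u.
  rewrite /quad_kernel -EFinB.
  have uu0 : y + gamma *: u = (y + gamma *: u0) + gamma *: (u - u0).
    by rewrite scalerBr -addrA subrKC.
  have /positive_opP[[linK _] _ _] := pK.
  have := K1 (u - u0).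
  have -> : '[y + gamma *: u, K (y + gamma *: u)] = '[u0, y] + gamma * '[u0, u0]
     + 2 * (gamma * '[u0, u - u0]) + gamma * (gamma * '[K (u - u0), u - u0]).
    rewrite innerC uu0 (positive_op_expand (y + _)) // Ku0 (linZ linK).
    rewrite !(innerZl, innerZr) (innerDr y) innerZr.
    by ring.
  move=> /(ler_wpM2l (ltW gamma0)).
  rewrite -!inner_norm.
  (* The value [-oo] contradicts the test-point bound; at [+oo] the whole term is [-oo]. *)
  case: (conjugate _ u) => [r| |] //= h1; rewrite ?lee_fin => h2.
    move: h1 h2; rewrite !innerE (innerC u0 u).
    by rewrite (innerC u0 y) (innerC u y); lra.
  by rewrite leNye.
apply: le_trans (conjugate_ge _ u0 _) => /=.
have := conjugate_quad_image (y + gamma *: u0) pK; rewrite Ku0 => ->.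
rewrite lee_fin !innerE inner_norm !(innerC u0 y); lra.
Qed.

End Conjugate.

(** * Compositions of strongly positive operators *)

Section Compositions.
Context {R : realType} {H G : hilbertType R} (L : H -> G) (gamma : R).
Hypotheses (bL : bounded_op L) (L1 : opnorm L <= 1) (gamma0 : 0 < gamma).

Let linL : linear L. Proof. by case: bL. Qed.

Let gammaV0 : 0 < gamma^-1. Proof. by rewrite invr_gt0. Qed.

Let N v := gamma *: (v - L (adjoint L v)).

Let innerN v w : '[N v, w] = gamma * ('[v, w] - '[adjoint L v, adjoint L w]).
Proof. by rewrite innerZl innerBl adjointP. Qed.

Lemma positive_op_defect : positive_op N.
Proof.
apply/positive_opP; split.
- have -> : N = gamma *: (idfun + (-1) *: (L \o adjoint L)).
    by apply/funext => v; rewrite !fctE scaleN1r.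
  apply/bounded_opZ/bounded_opD; first exact: bounded_op_id.
  by apply/bounded_opZ/bounded_op_comp => //; exact: bounded_op_adjoint.
- by move=> v w; rewrite (innerC v) !innerN (innerC w) (innerC (adjoint L w)).
- move=> v; rewrite innerN mulr_ge0 ?(ltW gamma0) // subr_ge0 !inner_norm.
  by rewrite ler_sqr ?nnegrE // adjoint_le1.
Qed.

Lemma strongly_positive_op_shift (B : G -> G) (c : R) : 0 < c ->
  strongly_positive_op B -> strongly_positive_op (fun v => B v + c *: v).
Proof.
move=> c0 sB; apply: (@strongly_positive_opD _ _ B (c *: idfun)) => //.
exact: (positive_opZ (ltW c0) positive_op_id).
Qed.

(** [C] is the inverse of [B], and [S] that of [C + N], which stays strongly positive because [N] is
    positive. *)
Lemma resolvent_cocomp_spec (B : G -> G) : strongly_positive_op B ->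
  exists C S : G -> G, let M v := C v + N v in
  [/\ strongly_positive_op C, strongly_positive_op S,
      cancel B C /\ cancel C B, cancel S M &
      resolvent_cocomp L gamma (setop_of B) = setop_of (adjoint L \o S \o L)].
Proof.
move=> sB; have [C [sC BK CK]] := strongly_positive_inverse sB.
have [S [sS MK SK]] := strongly_positive_inverse
  (strongly_positive_opD sC positive_op_defect).
by exists C, S; split => //; exact: resolvent_cocompE.
Qed.

(** Boundedness below makes [K] coercive, so that its inverse [W] exists. *)
Lemma resolvent_comp_spec (B : G -> G) : bounded_below L -> strongly_positive_op B ->
  exists (Q : G -> G) (W : H -> H),
  let P v := B v + gamma^-1 *: v in let K := adjoint L \o Q \o L in
  [/\ strongly_positive_op W, strongly_positive_op K, cancel Q P, cancel W K &
      resolvent_comp L gamma (setop_of B) = setop_of (fun x => W x - gamma^-1 *: x)].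
Proof.
move=> bbL sB.
have [Q [sQ PK QK]] := strongly_positive_inverse (strongly_positive_op_shift gammaV0 sB).
have sK := strongly_positive_op_sandwich bL bbL sQ.
have [W [sW KK WK]] := strongly_positive_inverse sK.
by exists Q, W; split => //; exact: resolvent_compE.
Qed.

(* Saddle-point form of [<D y, y>]: minimal value, over a constraint not
   involving [B], of functions affine in [B]. *)
Lemma res_cocomp_min (B : G -> G) y : strongly_positive_op B ->
  (forall z v, L y = z + N v ->
    '[res_cocomp L gamma B y, y] <= '[B z, z] + '[N v, v]) /\
  (exists z v, L y = z + N v /\
    '[res_cocomp L gamma B y, y] = '[B z, z] + '[N v, v]).
Proof.
move=> sB; have [C [S [sC _ [BK CK] SK ->]]] := resolvent_cocomp_spec sB.
rewrite op_of_setop_of /=; set v0 := S (L y).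
have Ly : L y = C v0 + N v0 by rewrite SK.
have Dy : '[adjoint L v0, y] = '[B (C v0), C v0] + '[N v0, v0].
  by rewrite innerC -adjointP // Ly CK innerDl (innerC v0).
split; last by exists (C v0), v0.
move=> z v Lz; rewrite Dy.
have := positive_op_convex (C v0) z (strongly_positive_positive sB).
have := positive_op_convex v0 v positive_op_defect; rewrite CK => h1 h2.
have [_ sN _] := (positive_opP _).1 positive_op_defect.
(* The first-order terms cancel: both pairs satisfy the constraint, so
   [(z - C v0) + N (v - v0) = 0]. *)
have : '[v0, z - C v0] + '[N v0, v - v0] = 0.
  rewrite sN -innerDr (_ : _ + _ = 0) ?inner0r //.
  have [linN _] := positive_op_defect.1.1.
  rewrite (linB linN) addrACA -opprD -Lz -Ly; exact: subrr.
lra.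
Qed.

(** Lagrange condition: at the minimizer [v0] the gradient [B v0 + gamma^-1 v0] equals [L (W x)], so
    it pairs equally with all feasible [v]. *)
Lemma res_comp_min (B : G -> G) x : bounded_below L -> strongly_positive_op B ->
  (forall v, adjoint L v = x -> '[res_comp L gamma B x, x] <=
    '[B v, v] + gamma^-1 * ('[v, v] - '[x, x])) /\
  (exists2 v, adjoint L v = x & '[res_comp L gamma B x, x] =
    '[B v, v] + gamma^-1 * ('[v, v] - '[x, x])).
Proof.
move=> bbL sB; have [Q [W [_ _ QK WK ->]]] := resolvent_comp_spec bbL sB.
rewrite op_of_setop_of /=; set v0 := Q (L (W x)).
have v0x : adjoint L v0 = x by rewrite -[RHS]WK.
have Wx v : adjoint L v = x -> '[W x, x] = '[B v0 + gamma^-1 *: v0, v].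
  by move=> vx; rewrite [_ + _]QK (adjointP bL) vx.
split; last first.
  by exists v0 => //; rewrite innerBl (Wx v0) // innerDl !innerZl; ring.
move=> v vx; have := Wx _ vx; have := Wx _ v0x.
have := positive_op_convex v0 v
  (strongly_positive_positive (strongly_positive_op_shift gammaV0 sB)).
rewrite /= innerBr innerBl (innerDl (B v)) !(innerZl _ v) (innerZl _ x).
by lra.
Qed.

Lemma positive_res_cocomp (B : G -> G) : strongly_positive_op B ->
  setop_in (resolvent_cocomp L gamma (setop_of B)) positive_op.
Proof.
move=> sB; have [C [S [_ sS _ _ ->]]] := resolvent_cocomp_spec sB.
exact/setop_in_setop_of/positive_op_sandwich/strongly_positive_positive.
Qed.

Lemma strongly_positive_res_cocomp (B : G -> G) :
  bounded_below L -> strongly_positive_op B ->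
  setop_in (resolvent_cocomp L gamma (setop_of B)) strongly_positive_op.
Proof.
move=> bbL sB; have [C [S [_ sS _ _ ->]]] := resolvent_cocomp_spec sB.
exact/setop_in_setop_of/strongly_positive_op_sandwich.
Qed.

(** Coercivity survives the subtraction of [gamma^-1 Id]: in the minimum formula [x = L^* v] gives
    [|x| <= |v|], so the form is at least [a |v|^2 >= a |x|^2]. *)
Lemma strongly_positive_res_comp (B : G -> G) :
  bounded_below L -> strongly_positive_op B ->
  setop_in (resolvent_comp L gamma (setop_of B)) strongly_positive_op.
Proof.
move=> bbL sB; have := fun x => (res_comp_min x bbL sB).2.
have [Q [W [sW _ _ _ ->]]] := resolvent_comp_spec bbL sB.
set D := (fun x => _); rewrite op_of_setop_of => hD; apply: setop_in_setop_of.
have [_ [a a0 cB]] := (strongly_positive_opP _).1 sB.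
have cD : coercive a D.
  move=> x; have [v vx ->] := hD x.
  have vx2 : `|x| ^+ 2 <= `|v| ^+ 2 by rewrite ler_sqr ?nnegrE // -vx adjoint_le1.
  apply: le_trans (_ : a * `|v| ^+ 2 <= _); first by rewrite ler_pM2l.
  apply: le_trans (cB v) _; rewrite lerDl mulr_ge0 ?(ltW gammaV0) //.
  by rewrite !inner_norm subr_ge0.
apply/strongly_positive_opP; split; last by exists a.
have [bW symW _] := (positive_opP _).1 (strongly_positive_positive sW).
apply/positive_opP; split.
- have -> : D = W + (- gamma^-1) *: idfun by apply/funext => x; rewrite !fctE scaleNr.
  by apply/bounded_opD/bounded_opZ/bounded_op_id.
- by move=> x y; rewrite /D !innerE symW.
- by move=> x; apply: le_trans (cD x); rewrite mulr_ge0 ?sqr_ge0 // ltW.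
Qed.

Let convex_strongly_positive (A B : G -> G) (lambda : R) : 0 < lambda -> lambda < 1 ->
  strongly_positive_op A -> strongly_positive_op B ->
  strongly_positive_op (lambda *: A + (1 - lambda) *: B).
Proof.
move=> l0 l1 sA sB; apply: strongly_positive_opD.
  exact: strongly_positive_opZ.
by apply/strongly_positive_positive/strongly_positive_opZ => //; rewrite subr_gt0.
Qed.

Let convex_positive (A B : H -> H) (lambda : R) : 0 < lambda -> lambda < 1 ->
  positive_op A -> positive_op B -> positive_op (lambda *: A + (1 - lambda) *: B).
Proof.
move=> l0 l1 pA pB; apply: positive_opD; apply: positive_opZ => //.
  exact: ltW.
by rewrite subr_ge0 ltW.
Qed.

Lemma res_cocomp_concave (A B : G -> G) (lambda : R) : 0 < lambda -> lambda < 1 ->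
  strongly_positive_op A -> strongly_positive_op B ->
  loewner_le
    (lambda *: res_cocomp L gamma A + (1 - lambda) *: res_cocomp L gamma B)
    (res_cocomp L gamma (lambda *: A + (1 - lambda) *: B)).
Proof.
move=> l0 l1 sA sB; have sAB := convex_strongly_positive l0 l1 sA sB.
apply: loewner_leP.
- by apply: convex_positive => //; apply: (positive_res_cocomp _).2.
- exact: (positive_res_cocomp sAB).2.
(* The minimizer for the mixture is feasible for [A] and for [B], so it bounds both of their
   minima. *)
move=> y; have [_ [z [v [Ly ->]]]] := res_cocomp_min y sAB.
have := (res_cocomp_min y sA).1 _ _ Ly; have := (res_cocomp_min y sB).1 _ _ Ly.
rewrite !fctE !innerE => hB hA; nra.
Qed.

Lemma res_comp_concave (A B : G -> G) (lambda : R) : bounded_below L ->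
  0 < lambda -> lambda < 1 ->
  strongly_positive_op A -> strongly_positive_op B ->
  loewner_le
    (lambda *: res_comp L gamma A + (1 - lambda) *: res_comp L gamma B)
    (res_comp L gamma (lambda *: A + (1 - lambda) *: B)).
Proof.
move=> bbL l0 l1 sA sB; have sAB := convex_strongly_positive l0 l1 sA sB.
apply: loewner_leP.
- by apply: convex_positive => //;
    exact/strongly_positive_positive/(strongly_positive_res_comp bbL _).2.
- exact/strongly_positive_positive/(strongly_positive_res_comp bbL sAB).2.
move=> x; have [_ [v vx ->]] := res_comp_min x bbL sAB.
have := (res_comp_min x bbL sA).1 _ vx; have := (res_comp_min x bbL sB).1 _ vx.
rewrite !fctE !innerE => hB hA; nra.
Qed.

Let inner_sandwich (Q : G -> G) x : '[L x, Q (L x)] = '[x, (adjoint L \o Q \o L) x].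
Proof. by rewrite adjointP. Qed.

Lemma prox_comp_quad (B : G -> G) : bounded_below L -> strongly_positive_op B ->
  prox_comp L gamma (quad_kernel B) = quad_kernel (res_comp L gamma B).
Proof.
move=> bbL sB; have [Q [W [_ sK QK WK ->]]] := resolvent_comp_spec bbL sB.
have [C [sC BK CK]] := strongly_positive_inverse sB.
have pB := strongly_positive_positive sB; have pC := strongly_positive_positive sC.
rewrite op_of_setop_of /prox_comp (conjugate_quad pB CK).
have -> : moreau_env gamma^-1 (quad_kernel C) \o L =
    quad_kernel (adjoint L \o Q \o L).
  (* With [v = Q (L x)], the proximal point is [B v]: indeed [L x = B v + gamma^-1 C (B v)]. *)
  apply/funext => x /=; rewrite (@moreau_env_quad _ _ _ _ _ (B (Q (L x)))) //.
    by rewrite BK inner_sandwich.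
  by rewrite BK QK.
rewrite (conjugate_quad (strongly_positive_positive sK) WK).
apply/funext => x; rewrite /quad_kernel -EFinB innerBr innerZr inner_norm.
by congr EFin; field; exact: lt0r_neq0.
Qed.

Lemma prox_cocomp_quad (B : G -> G) : strongly_positive_op B ->
  prox_cocomp L gamma (quad_kernel B) = quad_kernel (res_cocomp L gamma B).
Proof.
move=> sB; have [C [S [sC _ [BK CK] SK ->]]] := resolvent_cocomp_spec sB.
have pB := strongly_positive_positive sB; have pC := strongly_positive_positive sC.
have [F [sF EK FK]] := strongly_positive_inverse (strongly_positive_op_shift gamma0 sC).
rewrite op_of_setop_of /prox_cocomp /prox_comp invrK (conjugate_quad pB CK).
rewrite (conjugate_quad pC BK).
have -> : moreau_env gamma (quad_kernel B) \o L = quad_kernel (adjoint L \o F \o L).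
  (* With [v = F (L x)], the proximal point is [C v]: indeed [L x = C v + gamma B (C v)]. *)
  apply/funext => x /=; rewrite (@moreau_env_quad _ _ _ _ _ (C (F (L x)))) //.
    by rewrite CK inner_sandwich.
  by rewrite CK FK.
have -> : (2 * gamma^-1)^-1 = 2^-1 * gamma by rewrite invfM invrK.
apply/funext => y; apply: conjugate_quad_shift => //.
- exact/positive_op_sandwich/strongly_positive_positive.
(* [gamma K <= Id]: [|L x|^2] exceeds [gamma <L x, v>] by [<L x, C v> = |C v|^2 + gamma <v, C v> >=
   0]. *)
- move=> x; rewrite innerC -inner_sandwich.
  set v := F (L x); have Lx : L x = C v + gamma *: v by rewrite FK.
  apply: le_trans (_ : `|L x| ^+ 2 <= _); last first.
    by rewrite ler_sqr ?nnegrE // opnorm_le1.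
  rewrite -inner_norm {3}Lx innerDr innerZr lerDr.
  rewrite Lx innerDl innerZl (innerC v) addr_ge0 ?inner_ge0 //.
  by rewrite mulr_ge0 ?(ltW gamma0) //; exact: pC.2.
(* The fixed point is [u0 = L^* v] with [v = S (L y)]: the constraint turns [L y + gamma L (L^* v)]
   into [C v + gamma v], which [F] sends to [v]. *)
- rewrite /=; congr adjoint; rewrite (linD linL) (linZ linL).
  set v := S (L y); rewrite -[RHS]EK; congr F.
  by rewrite -(SK (L y)) -/v /N scalerBr -!addrA addNr addr0.
Qed.

End Compositions.

Theorem proposition3p1 (R : realType) (H G : hilbertType R)
  (L : H -> G) (hL : bounded_op L) (hL0 : 0 < opnorm L) (hL1 : opnorm L <= 1)
  (B : G -> G) (hB : strongly_positive_op B)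
  (gamma : R) (hgamma : 0 < gamma) :
  (* (i) *)
  setop_in (resolvent_cocomp L gamma (setop_of B)) positive_op /\
  (* (ii) *)
  prox_cocomp L gamma (quad_kernel B) = quad_kernel (res_cocomp L gamma B) /\
  (* (iii) *)
  ((forall A : G -> G, strongly_positive_op A ->
      setop_in (resolvent_cocomp L gamma (setop_of A)) positive_op) /\
   (forall lambda : R, 0 < lambda -> lambda < 1 ->
    forall A : G -> G, strongly_positive_op A ->
      loewner_le
        (lambda *: res_cocomp L gamma A + (1 - lambda) *: res_cocomp L gamma B)
        (res_cocomp L gamma (lambda *: A + (1 - lambda) *: B)))) /\
  (* (iv) *)
  (bounded_below L ->
    (* (a) *)
    (setop_in (resolvent_cocomp L gamma (setop_of B)) strongly_positive_op /\
     setop_in (resolvent_comp L gamma (setop_of B)) strongly_positive_op) /\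
    (* (b) *)
    prox_comp L gamma (quad_kernel B) = quad_kernel (res_comp L gamma B) /\
    (* (c) *)
    ((forall A : G -> G, strongly_positive_op A ->
        setop_in (resolvent_comp L gamma (setop_of A)) strongly_positive_op) /\
     (forall lambda : R, 0 < lambda -> lambda < 1 ->
      forall A : G -> G, strongly_positive_op A ->
        loewner_le
          (lambda *: res_comp L gamma A + (1 - lambda) *: res_comp L gamma B)
          (res_comp L gamma (lambda *: A + (1 - lambda) *: B))))).
Proof.
split; first exact: positive_res_cocomp.
split; first exact: prox_cocomp_quad.
split.
  split=> [A hA|lambda l0 l1 A hA]; first exact: positive_res_cocomp.
  exact: res_cocomp_concave.
move=> bbL; split.
  by split; [exact: strongly_positive_res_cocomp|exact: strongly_positive_res_comp].
split; first exact: prox_comp_quad.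
split=> [A hA|lambda l0 l1 A hA]; first exact: strongly_positive_res_comp.
exact: res_comp_concave.
Qed.
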